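(* The order-preserving logic $\vdash^{\leq}_{\mathbb{DN}}$ of the variety $\mathbb{DN}$ of distributive lattices with negation is not finitely based.
   Context: Fix the language with binary connectives $\land,\lor$, unary $\neg$ and constants $\bot,\top$; $Fm$ is the set of formulas built from a countably infinite set of propositional variables. A distributive lattice with negation is an algebra $\langle A;\land,\lor,\neg,\bot,\top\rangle$ whose reduct $\langle A;\land,\lor,\bot,\top\rangle$ is a bounded distributive lattice and which satisfies $\neg\bot\approx\top$ and $\neg(x\lor y)\approx\neg x\land\neg y$; $\mathbb{DN}$ is the variety of all such algebras. For a class $\mathbb{K}\subseteq\mathbb{DN}$, the order-preserving logic $\vdash^{\leq}_{\mathbb{K}}$ is the consequence relation on $Fm$ given by: $\Gamma\vdash^{\leq}_{\mathbb{K}}\varphi$ iff for every $\mathbf{A}\in\mathbb{K}$, every non-empty lattice filter $F$ of $\mathbf{A}$ and every homomorphism $h\colon Fm\to A$, $h[\Gamma]\subseteq F$ implies $h(\varphi)\in F$ (equivalently: $\emptyset\vdash\varphi$ iff $\mathbb{K}\models\varphi\approx\top$, and for $\Gamma\neq\emptyset$, $\Gamma\vdash\varphi$ iff $\mathbb{K}\models \gamma_1\land\dots\land\gamma_n\le\varphi$ for some $\gamma_1,\dots,\gamma_n\in\Gamma$). A Hilbert rule schema is a pair $\frac{\Gamma}{\varphi}$ with $\Gamma$ a finite (possibly empty) set of formulas; a set $\mathcal{R}$ of rule schemata determines the logic $\vdash_{\mathcal{R}}$ of Hilbert derivations using substitution instances of the rules. A logic is finitely based if it equals $\vdash_{\mathcal{R}}$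 for some finite set $\mathcal{R}$ of rule schemata. *)

(* Defs.v *)
From mathcomp Require Import all_boot all_order.
From mathcomp Require Import classical_sets cardinality.

Set Implicit Arguments.
Unset Strict Implicit.
Unset Printing Implicit Defensive.

Local Open Scope order_scope.

Inductive form : Type :=
| Var of nat
| Bot
| Top
| Neg of form
| And of form & form
| Or of form & form.

Fixpoint subst (s : nat -> form) (p : form) : form :=
  match p with
  | Var n => s n
  | Bot => Bot
  | Top => Top
  | Neg q => Neg (subst s q)
  | And q r => And (subst s q) (subst s r)
  | Or q r => Or (subst s q) (subst s r)
  end.

(* The one-element lattice, where bottom and top coincide, is allowed.
   Classically every type carries a choiceType structure, so the choice
   structure that MathComp attaches to a lattice carrier is no restriction. *)
Record dnAlgebra : Type := DNAlgebra {
  dn_disp : Order.disp_t;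
  dn_lattice :> tbDistrLatticeType dn_disp;
  dn_neg : dn_lattice -> dn_lattice;
  dn_neg_bot : dn_neg \bot = \top;
  dn_neg_join : forall x y : dn_lattice,
    dn_neg (x `|` y) = dn_neg x `&` dn_neg y
}.

(* Plain predicates, rather than [set dnAlgebra], to avoid a universe clash. *)
Definition DN : dnAlgebra -> Prop := fun=> True.

Definition is_hom (A : dnAlgebra) (h : form -> A) : Prop :=
  [/\ h Bot = \bot,
      h Top = \top,
      forall p, h (Neg p) = dn_neg (h p),
      forall p q, h (And p q) = h p `&` h q
    & forall p q, h (Or p q) = h p `|` h q].

(* Filters need not be proper. *)
Definition lattice_filter (A : dnAlgebra) (F : set A) : Prop :=
  [/\ exists x, F x,
      forall x y : A, F x -> x <= y -> F y
    & forall x y : A, F x -> F y -> F (x `&` y)].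

Definition logic : Type := set form -> form -> Prop.

Definition order_logic (K : dnAlgebra -> Prop) : logic := fun G p =>
  forall A : dnAlgebra, K A ->
  forall F : set A, lattice_filter F ->
  forall h : form -> A, is_hom h ->
  (forall q, G q -> F (h q)) -> F (h p).

Record rule : Type := Rule {
  premises : set form;
  conclusion : form;
  premises_finite : finite_set premises
}.

Inductive derivable (R : set rule) (G : set form) : form -> Prop :=
| derivable_hyp p : G p -> derivable R G p
| derivable_rule (r : rule) (s : nat -> form) :
    R r ->
    (forall q, premises r q -> derivable R G (subst s q)) ->
    derivable R G (subst s (conclusion r)).

Definition finitely_based (L : logic) : Prop :=
  exists R : set rule,
    finite_set R /\ forall G p, L G p <-> derivable R G p.

(* Main.v *)
(** A formula is evaluated at levels [0, 1, 2, ...], each carrying a Boolean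
    value, with negation at level [i] returning the Boolean complement of the
    value at level [i.+1].  When conjunction is honest at every level this is an
    algebra in DN.  If conjunction is instead the first projection at one single
    level [c], then the value at level [0] of a formula with fewer than [c]
    nested negations does not change, so every valid rule of negation depth less
    than [c] still preserves truth at level [0].  The valid rule from
    [Neg^c (x /\ y)] to [Neg^c (y /\ x)] does not, and finitely many rules have
    bounded negation depth. *)

Require Import Defs.
From mathcomp Require Import all_boot all_order.
From mathcomp Require Import classical_sets cardinality.

Set Implicit Arguments.
Unset Strict Implicit.
Unset Printing Implicit Defensive.

Import Order.LTheory.

Local Open Scope classical_set_scope.
Local Open Scope nat_scope.

Lemma finite_set_bounded (T : Type) (A : set T) (f : T -> nat) :
  finite_set A -> exists n, forall x, A x -> f x <= n.
Proof.
move=> /(finite_image f) /finite_seqP [s fAs].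
exists (\max_(m <- s) m) => x Ax.
apply: (leq_bigmax_seq (F := id)) => //.
have : [set` s] (f x) by rewrite -fAs; exists x.
by [].
Qed.

Lemma finite_set_bounded2 (T U : Type) (A : set T) (B : T -> set U)
    (f : U -> nat) :
  finite_set A -> (forall x, finite_set (B x)) ->
  exists n, forall x y, A x -> B x y -> f y <= n.
Proof.
move=> finA finB.
have [g gP] := boolp.choice (fun x => finite_set_bounded f (finB x)).
have [n nP] := finite_set_bounded g finA.
by exists n => x y Ax Bxy; apply: leq_trans (gP x y Bxy) (nP x Ax).
Qed.

Lemma subst_Var (p : form) : subst Var p = p.
Proof. by elim: p => //= [p ->|p -> q ->|p -> q ->]. Qed.

Fixpoint neg_depth (p : form) : nat :=
  match p with
  | Var _ | Bot | Top => 0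
  | Neg q => (neg_depth q).+1
  | And q r | Or q r => maxn (neg_depth q) (neg_depth r)
  end.

Fixpoint level_eval (b : pred nat) (v : nat -> nat -> bool) (p : form) (i : nat)
    : bool :=
  match p with
  | Var n => v n i
  | Bot => false
  | Top => true
  | Neg q => ~~ level_eval b v q i.+1
  | And q r =>
      if b i then level_eval b v q i else level_eval b v q i && level_eval b v r i
  | Or q r => level_eval b v q i || level_eval b v r i
  end.

Lemma level_eval_subst b v s p i :
  level_eval b v (subst s p) i = level_eval b (fun n => level_eval b v (s n)) p i.
Proof. by elim: p i => //= [p IHp|p IHp q IHq|p IHp q IHq] i; rewrite ?IHp ?IHq. Qed.

(** Only negation raises the level, one step at a time, so evaluation from level [i] never goes
    beyond [i + neg_depth p]. *)
Lemma eq_level_eval_shallow b b' c v p i :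
  (forall j, j < c -> b j = b' j) -> i + neg_depth p < c ->
  level_eval b v p i = level_eval b' v p i.
Proof.
move=> eqb; elim: p i => //= [p IHp|p IHp q IHq|p IHp q IHq] i.
- by rewrite addnS -addSn => /IHp ->.
- rewrite addn_maxr gtn_max => /andP[ip iq].
  by rewrite IHp // IHq // eqb //; apply: leq_ltn_trans (leq_addr _ _) ip.
- by rewrite addn_maxr gtn_max => /andP[/IHp -> /IHq ->].
Qed.

Lemma level_eval_iter_Neg b v p n i :
  level_eval b v (iter n Neg p) i = odd n (+) level_eval b v p (i + n).
Proof.
elim: n i => [|n IHn] i; first by rewrite addn0.
by rewrite iterS /= IHn addSnnS addNb.
Qed.

(** Elements of the algebra stand for the set of levels at which a formula is true. *)
Definition shift_neg (S : set nat) : set nat := [set i | ~ S i.+1].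

Lemma shift_neg_bot : shift_neg \bot%O = \top%O.
Proof. by apply/seteqP; split => // i _ []. Qed.

Lemma shift_neg_join (S S' : set nat) :
  shift_neg (S `|` S')%O = (shift_neg S `&` shift_neg S')%O.
Proof.
apply/seteqP; split => i /=.
- by move=> nSS'; split=> ?; apply: nSS'; [left|right].
- by move=> [nS nS'] [].
Qed.

Definition shift_algebra : dnAlgebra := DNAlgebra shift_neg_bot shift_neg_join.

Lemma level_eval_hom v :
  is_hom (A := shift_algebra) (fun p => [set i | level_eval pred0 v p i]).
Proof.
split=> [||p|p q|p q]; apply/seteqP; split=> i //=.
- by move/negP.
- by move/negP.
- by move/andP.
- by move/andP.
- by move/orP.
- by move/orP.
Qed.

Lemma DN_logic_level_eval (G : set form) p v :
  order_logic DN G p -> (forall q, G q -> level_eval pred0 v q 0) ->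
  level_eval pred0 v p 0.
Proof.
move=> Gp Gv.
(* Truth at level 0 is membership in the principal filter of the sets containing 0. *)
apply: (Gp shift_algebra I [set S : set nat | S 0] _ _ (level_eval_hom v)) Gv.
split=> [|S S' S0|S S' S0 S'0]; first by exists setT.
- by rewrite subsetEset => /(_ 0); apply.
- by split.
Qed.

(** Instances of a rule can be arbitrarily deep, but a substitution can be absorbed into the
    valuation, so only the depth of the schema itself matters. *)
Lemma derivable_level_eval (R : set rule) (G : set form) c v p :
  (forall r, R r -> order_logic DN (premises r) (conclusion r)) ->
  (forall r, R r -> neg_depth (conclusion r) < c) ->
  (forall r q, R r -> premises r q -> neg_depth q < c) ->
  (forall q, G q -> level_eval (pred1 c) v q 0) ->
  derivable R G p -> level_eval (pred1 c) v p 0.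
Proof.
move=> sndR concR premR Gv; elim=> [q /Gv //|r s Rr _ IH].
have shallow := @eq_level_eval_shallow (pred1 c) pred0 c.
have eqb j : j < c -> pred1 c j = pred0 j by move=> jc; apply: ltn_eqF.
rewrite level_eval_subst shallow // ?add0n ?concR //.
apply: DN_logic_level_eval (sndR r Rr) _ => q rq.
by rewrite -shallow // ?add0n ?(premR r) // -level_eval_subst; apply: IH.
Qed.

Lemma DN_logic_And_comm c p q :
  order_logic DN [set iter c Neg (And p q)] (iter c Neg (And q p)).
Proof.
move=> A _ F _ h [_ _ hN hA _] /(_ _ erefl).
suff -> : h (iter c Neg (And p q)) = h (iter c Neg (And q p)) by [].
elim: c => [|c IHc] /=; first by rewrite !hA meetC.
by rewrite !hN IHc.
Qed.

Theorem theorem3p8 : ~ finitely_based (order_logic DN).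
Proof.
move=> [R [finR RP]].
have sndR r : R r -> order_logic DN (premises r) (conclusion r).
  (* The identity substitution derives the conclusion of [r] from its own premises. *)
  move=> Rr; apply/RP; rewrite -[conclusion r]subst_Var.
  by apply: derivable_rule => // q rq; rewrite subst_Var; apply: derivable_hyp.
have [m mP] := finite_set_bounded (neg_depth \o conclusion) finR.
have [n nP] := finite_set_bounded2 neg_depth finR premises_finite.
pose c := (maxn m n).+1.
(* The term [odd c] cancels the parity of the [c] negations: at level 0, [iter c Neg] makes [Var 0]
   true and [Var 1] false. *)
pose v k (_ : nat) := (k == 0) (+) odd c.
have /RP := @DN_logic_And_comm c (Var 0) (Var 1).
move=> /(@derivable_level_eval R _ c v) -/(_ sndR) derP.
suff : level_eval (pred1 c) v (iter c Neg (And (Var 1) (Var 0))) 0.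
  by rewrite level_eval_iter_Neg add0n /= eqxx addbb.
apply: derP => [r Rr|r q Rr rq|_ ->].
- by rewrite ltnS leq_max mP.
- by rewrite ltnS leq_max (nP r) ?orbT.
- by rewrite level_eval_iter_Neg add0n /= eqxx addbCA addbb.
Qed.
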